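(* The square norms of the monic orthogonal polynomials $(P_n^{(\lambda)})_n$ with respect to the weight $W^{(\lambda)}(x)=\frac{a^x}{x!}(I+A)^{x+\lambda}T^{(\lambda)}(I+A^* )^{x+\lambda}$, $x\in\mathbb N_0$, have the LDU decomposition $$\mathcal H_n^{(\lambda)}=L_0^{-1}(I+A)^{n+\lambda}\mathcal D_n^{(\lambda)}(I+A^* )^{n+\lambda}(L_0^* )^{-1}$$ for some positive definite diagonal matrix $\mathcal D_n^{(\lambda)}$ satisfying the recurrence, for $n\ge2$, $$\mathcal D_n^{(\lambda)}=a^2A\mathcal D_{n-1}^{(\lambda)}A^*-a^2\mathcal D_{n-1}^{(\lambda)}A^*(\mathcal D_{n-1}^{(\lambda)})^{-1}A\mathcal D_{n-1}^{(\lambda)}+a\mathcal D_{n-1}^{(\lambda)}+\mathcal D_{n-1}^{(\lambda)}(\mathcal D_{n-2}^{(\lambda)})^{-1}\mathcal D_{n-1}^{(\lambda)},$$ and $$\mathcal D_1^{(\lambda)}=a^2A\mathcal D_0^{(\lambda)}A^*-a^2\mathcal D_0^{(\lambda)}A^*(\mathcal D_0^{(\lambda)})^{-1}A\mathcal D_0^{(\lambda)}+a\mathcal D_0^{(\lambda)}.$$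
   Context: $N\ge1$, $a>0$, $\lambda\in\mathbb N_0=\{0,1,2,\dots\}$; $\mu_1,\dots,\mu_N>0$ and $\delta_1^{(\lambda)},\dots,\delta_N^{(\lambda)}>0$ are arbitrary. $A$ is the $N\times N$ matrix with $A_{j,k}=\mu_j/\mu_{j-1}$ if $j=k+1$ and $0$ otherwise; $T^{(\lambda)}=\mathrm{diag}(\delta_1^{(\lambda)},\dots,\delta_N^{(\lambda)})$. $L_0$ is lower triangular with $(L_0)_{j,k}=\frac{\mu_j}{\mu_k}\frac{(-a)^{j-k}}{(j-k)!}$ for $j\ge k$. With $\langle P,Q\rangle^{(\lambda)}=\sum_{x=0}^\infty P(x)W^{(\lambda)}(x)Q(x)^*$, $P_n^{(\lambda)}$ are the monic matrix orthogonal polynomials, $\deg P_n^{(\lambda)}=n$, $\langle P_m^{(\lambda)},P_n^{(\lambda)}\rangle^{(\lambda)}=\mathcal H_m^{(\lambda)}\delta_{m,n}$. *)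

(* Defs.v *)
From mathcomp Require Import all_boot all_order all_algebra.
From mathcomp Require Import complex.
From mathcomp Require Import all_classical all_reals all_analysis.

Set Implicit Arguments.
Unset Strict Implicit.
Unset Printing Implicit Defensive.

Import Order.TTheory GRing.Theory Num.Theory.
Import numFieldNormedType.Exports.

Local Open Scope ring_scope.
Local Open Scope complex_scope.
Local Open Scope sesquilinear_scope.
Local Open Scope classical_set_scope.

(* The field of complex numbers is R[i].  Matrices have size N.+1 (size at least 1), so that 'M[R[i]]_N.+1 is a unit
   ring and {poly 'M[R[i]]_N.+1} is the ring of matrix polynomials.
   Indices start at 0. *)

(* Conjugate transpose, typed over R[i] so that the ring structures inferred on
   M and on its adjoint agree syntactically. *)
Definition adjmx (R : realType) (m n : nat) (M : 'M[R[i]]_(m, n)) :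
  'M[R[i]]_(n, m) := M^t*.

Section CharlierWeight.
Variables (R : realType) (N : nat).
Implicit Types (a : R) (mu delta : 'I_N.+1 -> R) (lambda x : nat).

Definition Amx mu : 'M[R[i]]_N.+1 :=
  \matrix_(j, k) (if j == k.+1 :> nat then mu j / mu k else 0)%:C.

Definition Tmx delta : 'M[R[i]]_N.+1 :=
  diag_mx (\row_j (delta j)%:C).

Definition L0mx a mu : 'M[R[i]]_N.+1 :=
  \matrix_(j, k)
    (if (k <= j)%N then mu j / mu k * ((- a) ^+ (j - k) / ((j - k)`!)%:R)
     else 0)%:C.

Definition charlier_weight a mu delta lambda x : 'M[R[i]]_N.+1 :=
  (a ^+ x / (x`!)%:R)%:C *:
    ((1 + Amx mu) ^+ (x + lambda) * Tmx delta *
     (1 + adjmx (Amx mu)) ^+ (x + lambda)).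

End CharlierWeight.

Section MatrixOrthogonality.
Variables (R : realType) (N : nat).
Implicit Types (W : nat -> 'M[R[i]]_N.+1) (P Q : {poly 'M[R[i]]_N.+1}).

(* P.[x%:R] is P(x): x%:R is the central matrix x I.  The limit is taken in the
   library topology of matrices over R[i]^o, i.e. entrywise for the modulus. *)
Definition mxinner W P Q : 'M[R[i]]_N.+1 :=
  limn (fun n : nat =>
    (\sum_(0 <= x < n) P.[x%:R] * W x * adjmx Q.[x%:R]) : 'M[R[i]^o]_N.+1).

Definition monic_orthogonal W (P : nat -> {poly 'M[R[i]]_N.+1})
    (H : nat -> 'M[R[i]]_N.+1) : Prop :=
  (forall n, P n \is monic /\ size (P n) = n.+1) /\
  (forall m n, mxinner W (P m) (P n) = if m == n then H m else 0).

(* On R[i], 0 < z means that z is real and positive. *)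
Definition posdefmx (M : 'M[R[i]]_N.+1) : Prop :=
  adjmx M = M /\ forall v : 'cV[R[i]]_N.+1, v != 0 -> 0 < (adjmx v *m M *m v) 0 0.

End MatrixOrthogonality.

(* Main.v *)
Require Import Defs.
From mathcomp Require Import all_boot all_order all_algebra.
From mathcomp Require Import complex.
From mathcomp Require Import ring.
From mathcomp Require Import all_classical all_reals all_analysis.

(** Write B = 1 + A, As and Bs for the adjoints of A and B, and W for the weight.
The weight obeys the Pearson equation (x + 1) W (x + 1) = a B W(x) Bs.  Reading
it as an adjunction for the inner product < P, Q > gives two operators on matrix
polynomials,

  (lowering Q)(x) = Q (x + 1) B,   (raising P)(x) = x P (x - 1) B^-1,

with < raising P, Q > = a < P, lowering Q > [ip_raising].  They satisfy the
Heisenberg relation lowering o raising = 1 + raising o lowering at every natural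
number, lowering preserves the degree, and raising increases it by one.  By
adjunction and orthogonality, raising P_n only has components along P_n and
P_{n+1}, and lowering P_n only along P_{n-1} and P_n; the leading coefficients
give these components in terms of B and of the norms H_n.  The Parseval
identity turns

  < raising P_n, raising P_n > = a < P_n, P_n > + a^2 < lowering P_n, lowering P_n >

into a recurrence for the norms [ladder_rec0], [ladder_recS]:

  B^-1 H_{n+1} Bs^-1 = a^2 (B H_n Bs - H_n Bs H_n^-1 B H_n) + a H_n
                       + H_n Bs^-1 H_{n-1}^-1 B^-1 H_n.

Since A and L0 = exp (- a A) commute, D_n = C_n^-1 H_n Cs_n^-1 with
C_n = L0^-1 B^(n + lambda) and adjoint Cs_n obeys the same recurrence with the
powers of B removed [normalized_rec0], [normalized_recS]; replacing B by 1 + A then cancels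
the cross terms and leaves the recurrence of the theorem
[cross_terms_cancel].

Positivity of D_n is that of H_n = < P_n, P_n >: if r P_n (x) = 0 for every
natural number x, then r kills the leading coefficient of P_n, that is r = 0.

Diagonality is commutation with J = diag (0, 1, .., N).  The matrix A has degree
one for the grading that J defines, [J, A] = A, so M -> A M As and M -> As M A
preserve the commutant of J and so does the recurrence; only D_0 is left.  There
[J, B^x] = x A B^(x-1), the factor x is absorbed by the Pearson equation, and
the moment X = sum_x a^x / x! B^x T Bs^x satisfies
J X - X J = a (A X Bs - B X As) = a (A X - X As) [ip_one].  Conjugation by the
exponential L0, for which [J, L0] = - a A L0, removes exactly this defect
[comm_grading_L0_sandwich]. *)

Import Order.TTheory GRing.Theory Num.Theory.
Import numFieldNormedType.Exports.

Local Open Scope ring_scope.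
Local Open Scope complex_scope.
Set Implicit Arguments.
Unset Strict Implicit.

(** * Adjoints and positive definite matrices *)

Section Adjoint.
Variables (R : realType).

Lemma adjmxE (m n : nat) (M : 'M[R[i]]_(m, n)) j k : adjmx M j k = conjc (M k j).
Proof. by rewrite !mxE. Qed.

Lemma adjmxK (m n : nat) (M : 'M[R[i]]_(m, n)) : adjmx (adjmx M) = M.
Proof. by apply/matrixP=> j k; rewrite !adjmxE conjcK. Qed.

Lemma adjmx_mul (m n p : nat) (M : 'M[R[i]]_(m, n)) (K : 'M[R[i]]_(n, p)) :
  adjmx (M *m K) = adjmx K *m adjmx M.
Proof.
apply/matrixP=> j k; rewrite adjmxE !mxE rmorph_sum; apply: eq_bigr => l _.
by rewrite rmorphM mulrC !adjmxE.
Qed.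

Variable N : nat.
Implicit Types M K : 'M[R[i]]_N.+1.

Lemma adjmxD M K : adjmx (M + K) = adjmx M + adjmx K.
Proof. by apply/matrixP=> j k; rewrite !mxE rmorphD. Qed.

Lemma adjmx0 : adjmx (0 : 'M[R[i]]_N.+1) = 0.
Proof. by apply/matrixP=> j k; rewrite !mxE rmorph0. Qed.

Lemma adjmx1 : adjmx (1 : 'M[R[i]]_N.+1) = 1.
Proof. by apply/matrixP=> j k; rewrite !mxE rmorph_nat eq_sym. Qed.

Lemma adjmxM M K : adjmx (M * K) = adjmx K * adjmx M.
Proof. exact: adjmx_mul. Qed.

Lemma adjmxZ (c : R) M : adjmx (c%:C *: M) = c%:C *: adjmx M.
Proof. by apply/matrixP=> j k; rewrite !adjmxE !mxE rmorphM /= oppr0. Qed.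

Lemma adjmxX M n : adjmx (M ^+ n) = adjmx M ^+ n.
Proof.
by elim: n => [|n IH]; rewrite ?expr0 ?adjmx1// exprS adjmxM IH -exprSr.
Qed.

Lemma adjmxMn M n : adjmx (M *+ n) = adjmx M *+ n.
Proof. by elim: n => [|n IH]; rewrite ?adjmx0// !mulrS adjmxD IH. Qed.

Lemma adjmx_unit M : (adjmx M \is a GRing.unit) = (M \is a GRing.unit).
Proof.
suff H K : K \is a GRing.unit -> adjmx K \is a GRing.unit.
  by apply/idP/idP => [/H|/H//]; rewrite adjmxK.
move=> /unitrP[L [LK KL]]; apply/unitrP; exists (adjmx L).
by rewrite -!adjmxM LK KL adjmx1.
Qed.

Lemma adjmxV M : adjmx M^-1 = (adjmx M)^-1.
Proof.
have [uM|nuM] := boolP (M \is a GRing.unit); last first.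
  by rewrite !invr_out// adjmx_unit.
apply: (mulIr (x := adjmx M)); rewrite ?adjmx_unit// -adjmxM mulrV// adjmx1.
by rewrite mulVr// adjmx_unit.
Qed.

End Adjoint.

Section Posdef.
Variables (R : realType) (N : nat).
Implicit Types (M K : 'M[R[i]]_N.+1).

Lemma posdefmx_unit M : posdefmx M -> M \is a GRing.unit.
Proof.
move=> [_ Mpos].
change (M \in unitmx); rewrite unitmxE unitfE; apply/det0P => -[r r0 rM].
have := Mpos (adjmx r); rewrite adjmxK rM mul0mx mxE ltxx => h.
suff : adjmx r != 0 by move=> /h.
apply: contra_neq r0 => r0; rewrite -[r]adjmxK r0.
by apply/matrixP => j k; rewrite adjmxE !mxE conjc0.
Qed.

Lemma posdefmx_congr M K : K \is a GRing.unit -> posdefmx M ->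
  posdefmx (K * M * adjmx K).
Proof.
move=> uK [Mh Mpos]; split; first by rewrite !adjmxM adjmxK Mh mulrA.
move=> v v0.
have uKs : adjmx K \in unitmx by change (adjmx K \is a GRing.unit); rewrite adjmx_unit.
have w0 : adjmx K *m v != 0.
  by apply: contra_neq v0 => w0; rewrite -[v](mulKmx uKs) w0 mulmx0.
have := Mpos _ w0; rewrite adjmx_mul adjmxK.
by rewrite -[K * M * _]/(K *m M *m adjmx K) !mulmxA.
Qed.

End Posdef.

(** * Entrywise summation of matrix series *)

Section Summation.
Variables (R : realType) (N : nat).
Implicit Types (f g : nat -> 'M[R[i]]_N.+1) (M K S : 'M[R[i]]_N.+1).

Local Open Scope classical_set_scope.

(** The adjunctions and the positivity are statements about single entries of
partial sums, so summability is recorded entry by entry; [mxseries_lim] brings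
it back to the limit in the matrix topology. *)
Definition mxseries_to f S := forall j k : 'I_N.+1,
  (fun n => ((\sum_(0 <= x < n) f x) j k : R[i]^o)) @ \oo --> (S j k : R[i]^o).

Lemma mxseries_lim f S : mxseries_to f S ->
  limn (fun n => (\sum_(0 <= x < n) f x) : 'M[R[i]^o]_N.+1) = S.
Proof.
move=> fS.
apply: (@cvg_lim 'M[R[i]^o]_N.+1); first exact: norm_hausdorff.
move=> U [P PS PU].
have : \forall n \near \oo, forall j k, P j k ((\sum_(0 <= x < n) f x) j k).
  by apply: filter_forall => j; apply: filter_forall => k; exact: fS (PS j k).
by apply: filterS => n Pn; apply: PU.
Qed.

Lemma normc_ge_Im (z : R[i]) : `|complex.Im z|%:C <= `|z|.
Proof.
rewrite normc_def lecR -sqrtr_sqr ler_sqrt; first by rewrite lerDr sqr_ge0.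
by rewrite addr_ge0// sqr_ge0.
Qed.

Lemma normc_le_ReIm (z : R[i]) : `|z| <= (`|complex.Re z| + `|complex.Im z|)%:C.
Proof.
rewrite {1}[z]complexE rmorphD; apply: (le_trans (ler_normD _ _)).
rewrite normrM complexiE normCi mul1r.
by rewrite !normc_def /= !expr0n /= !addr0 !sqrtr_sqr.
Qed.

(** Completeness and order are available for the real line; this is the bridge to
complex entries. *)
Lemma cvg_complexP (u : nat -> R[i]) (l : R[i]) :
  (u : nat -> R[i]^o) @ \oo --> (l : R[i]^o) <->
  ((fun n => complex.Re (u n)) @ \oo --> complex.Re l /\
   (fun n => complex.Im (u n)) @ \oo --> complex.Im l).
Proof.
split=> [ul|[/cvgrPdist_le ur /cvgrPdist_le ui]].
  move/cvgrPdist_le : ul => ul.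
  split; apply/cvgrPdist_le => e e0; have := ul e%:C; rewrite ltcR => /(_ e0).
    apply: filterS => n; rewrite -lecR; apply: le_trans.
    by rewrite -raddfB normc_ge_Re.
  apply: filterS => n; rewrite -lecR; apply: le_trans.
  by rewrite -raddfB normc_ge_Im.
apply/cvgrPdist_le => e; rewrite ltcE /= => /andP[/eqP e1 e0].
have -> : e = (complex.Re e)%:C by case: e e1 {e0} => ? ? /= ->.
have e20 : 0 < complex.Re e / 2 by rewrite divr_gt0.
near=> n.
apply: (le_trans (normc_le_ReIm _)).
rewrite lecR [leRHS]splitr lerD// raddfB /=.
  by near: n; exact: ur.
by near: n; exact: ui.
Unshelve. all: by end_near. Qed.

Lemma mxseries_to_unique f S S' : mxseries_to f S -> mxseries_to f S' -> S = S'.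
Proof. by move=> /mxseries_lim <- /mxseries_lim <-. Qed.

Lemma mxseries_to_eq f g S : mxseries_to f S -> f =1 g -> mxseries_to g S.
Proof. by move=> fS /funext <-. Qed.

Lemma mxseries_toD f g S S' : mxseries_to f S -> mxseries_to g S' ->
  mxseries_to (fun x => f x + g x) (S + S').
Proof.
move=> fS gS j k; rewrite mxE.
rewrite (_ : (fun _ => _) = (fun n => (\sum_(0 <= x < n) f x) j k : R[i]^o) \+
   (fun n => (\sum_(0 <= x < n) g x) j k : R[i]^o)); first exact: cvgD (fS j k) (gS j k).
by apply/funext => n; rewrite big_split mxE.
Qed.

Lemma mxseries_toM f M K S : mxseries_to f S ->
  mxseries_to (fun x => M * f x * K) (M * S * K).
Proof.
move=> fS j k.
have E (T : 'M[R[i]]_N.+1) :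
    (M * T * K) j k = \sum_p \sum_q M j p * (T p q * K q k).
  by rewrite -mulrA mxE; apply: eq_bigr => p _; rewrite mxE mulr_sumr.
rewrite E (_ : (fun _ => _) = (fun n =>
    \sum_p \sum_q M j p * ((\sum_(0 <= x < n) f x) p q * K q k) : R[i]^o)).
  apply: (cvg_big add_continuous) => p _; apply: (cvg_big add_continuous) => q _.
  by apply: cvgMr; apply: cvgMl; exact: fS.
by apply/funext => n; rewrite -E mulr_sumr mulr_suml.
Qed.

Lemma mxseries_to_adj f S : mxseries_to f S ->
  mxseries_to (fun x => adjmx (f x)) (adjmx S).
Proof.
move=> fS j k; rewrite adjmxE.
rewrite (_ : (fun _ => _) = (fun n => conjc ((\sum_(0 <= x < n) f x) k j))); last first.
  apply/funext => n; rewrite -adjmxE; congr (fun_of_matrix _ j k).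
  elim: n => [|n IH]; first by rewrite !big_nil adjmx0.
  by rewrite !big_nat_recr//= adjmxD IH.
have /cvg_complexP[] := fS k j.
case: (S k j) => s t /= hr hi; apply/cvg_complexP => /=; split.
  by apply: cvg_trans hr; apply: near_eq_cvg; near=> n; case: (fun_of_matrix _ _ _).
apply: cvg_trans (cvgN hi); apply: near_eq_cvg; near=> n => /=.
by rewrite /GRing.opp/=; case: (fun_of_matrix _ _ _).
Unshelve. all: by end_near. Qed.

(** The vanishing of the term of index 0 is what makes a discrete integration by
parts free of boundary terms. *)
Lemma mxseries_to_shift f S : f 0 = 0 ->
  mxseries_to (fun x => f x.+1) S -> mxseries_to f S.
Proof.
move=> f0 fS j k; rewrite -cvg_shiftS.
rewrite (_ : (fun _ => _) = (fun n => (\sum_(0 <= x < n) f x.+1) j k)); first exact: fS.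
by apply/funext=> n; rewrite /= big_nat_recl// f0 add0r.
Qed.

(** A sum of nonnegative terms dominates each of them.  With [mxseries_toM] the
entry (0, 0) can be made the value of any quadratic form. *)
Lemma mxseries_to_ge_term f S : mxseries_to f S ->
  (forall x, 0 <= f x 0 0) -> forall x, f x 0 0 <= S 0 0.
Proof.
move=> fS f0 x.
have /cvg_complexP[hr hi] := fS 0 0.
have sE n : (\sum_(0 <= x < n) f x) 0 0 = \sum_(0 <= x < n) f x 0 0.
  by rewrite summxE.
have s0 n : complex.Im ((\sum_(0 <= x < n) f x) 0 0) = 0.
  by apply: ger0_Im; rewrite sE sumr_ge0.
rewrite lecE; apply/andP; split.
  rewrite (ger0_Im (f0 x)); apply/eqP; apply: (cvg_unique _ hi) => //.
  by rewrite (funext s0); exact: cvg_cst.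
apply: (cvgr_to_ge hr); exists x.+1 => // n /= xn.
have re0 (z : R[i]) : 0 <= z -> 0 <= complex.Re z by rewrite lecE => /andP[].
rewrite sE (@big_cat_nat _ _ _ x.+1)//= big_nat_recr//= !raddfD /=.
rewrite -addrA addrCA lerDl addr_ge0//; apply: re0; exact: sumr_ge0.
Qed.

End Summation.

(** * Convergence against the Poisson weights *)

Section Growth.
Variables (R : realType) (N : nat).
Implicit Types (f g : nat -> 'M[R[i]]_N.+1) (M K S : 'M[R[i]]_N.+1).

Local Notation normc := Normc.normc.

(** A submultiplicative norm that bounds every entry. *)
Definition mxl1 M : R := \sum_j \sum_k normc (M j k).

Lemma normc_ge0 (z : R[i]) : 0 <= normc z.
Proof. by case: z => ? ? /=; exact: sqrtr_ge0. Qed.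

Lemma normc_sum (I : Type) (r : seq I) (F : I -> R[i]) :
  normc (\sum_(l <- r) F l) <= \sum_(l <- r) normc (F l).
Proof.
elim/big_ind2 : _ => //[|x1 x2 y1 y2 h1 h2]; first by rewrite Normc.normc0.
by apply: le_trans (le_normcD _ _) (lerD h1 h2).
Qed.

Lemma mxl1_ge0 M : 0 <= mxl1 M.
Proof. by apply: sumr_ge0 => j _; apply: sumr_ge0 => k _; exact: normc_ge0. Qed.

Lemma normc_le_mxl1 M j k : normc (M j k) <= mxl1 M.
Proof.
rewrite /mxl1 (bigD1 j)//= (bigD1 k)//= -addrA lerDl addr_ge0//.
  by apply: sumr_ge0 => ? _; exact: normc_ge0.
by apply: sumr_ge0 => ? _; apply: sumr_ge0 => ? _; exact: normc_ge0.
Qed.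

Lemma mxl1D M K : mxl1 (M + K) <= mxl1 M + mxl1 K.
Proof.
rewrite -big_split; apply: ler_sum => j _ /=; rewrite -big_split.
by apply: ler_sum => k _ /=; rewrite mxE le_normcD.
Qed.

Lemma mxl1M M K : mxl1 (M * K) <= mxl1 M * mxl1 K.
Proof.
rewrite /mxl1 mulr_suml; apply: ler_sum => j _.
apply: (@le_trans _ _ (\sum_k \sum_l normc (M j l) * normc (K l k))).
  apply: ler_sum => k _; rewrite mxE (le_trans (normc_sum _ _))//.
  by apply: ler_sum => l _; rewrite Normc.normcM.
rewrite exchange_big mulr_suml /=; apply: ler_sum => l _.
rewrite -mulr_sumr ler_wpM2l ?normc_ge0// [leRHS](bigD1 l)//= lerDl.
by apply: sumr_ge0 => ? _; apply: sumr_ge0 => ? _; exact: normc_ge0.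
Qed.

Lemma mxl1_adj M : mxl1 (adjmx M) = mxl1 M.
Proof.
rewrite /mxl1 exchange_big; apply: eq_bigr => j _; apply: eq_bigr => k _.
by rewrite adjmxE; case: (M j k) => ? ? /=; rewrite sqrrN.
Qed.

(** All factors of the weighted products grow at most exponentially, a class
stable under sums and products, and 1 / x! beats any exponential. *)
Definition exp_growth f :=
  exists C c : R, [/\ 0 <= C, 1 <= c & forall x, mxl1 (f x) <= C * c ^+ x].

Lemma exp_growth_cst M : exp_growth (fun=> M).
Proof.
by exists (mxl1 M), 1; split=> [|//|x]; rewrite ?mxl1_ge0// expr1n mulr1.
Qed.

Lemma exp_growthX M : exp_growth (fun x => M ^+ x).
Proof.
exists (mxl1 1), (mxl1 M + 1); split; rewrite ?mxl1_ge0 ?lerDr ?mxl1_ge0// => x.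
elim: x => [|x IH]; first by rewrite !expr0 mulr1.
rewrite exprSr (le_trans (mxl1M _ _))// exprSr mulrA.
by apply: ler_pM; rewrite ?mxl1_ge0// lerDl.
Qed.

Lemma exp_growthM f g : exp_growth f -> exp_growth g ->
  exp_growth (fun x => f x * g x).
Proof.
move=> [C [c [C0 c1 fC]]] [D [d [D0 d1 gD]]]; exists (C * D), (c * d); split.
- exact: mulr_ge0.
- exact: mulr_ege1.
move=> x; rewrite exprMn mulrACA (le_trans (mxl1M _ _))//.
by apply: ler_pM => //; exact: mxl1_ge0.
Qed.

Lemma exp_growthD f g : exp_growth f -> exp_growth g ->
  exp_growth (fun x => f x + g x).
Proof.
move=> [C [c [C0 c1 fC]]] [D [d [D0 d1 gD]]]; exists (C + D), (c * d); split.
- exact: addr_ge0.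
- exact: mulr_ege1.
move=> x; rewrite mulrDl (le_trans (mxl1D _ _))// lerD//.
  rewrite (le_trans (fC x))// ler_wpM2l// lerXn2r// ?nnegrE ?ler_peMr//;
  by rewrite ?mulr_ge0// (le_trans ler01).
rewrite (le_trans (gD x))// ler_wpM2l// lerXn2r// ?nnegrE ?ler_peMl//;
by rewrite ?mulr_ge0// (le_trans ler01).
Qed.

Lemma exp_growth_adj f : exp_growth f -> exp_growth (fun x => adjmx (f x)).
Proof.
by move=> [C [c [C0 c1 fC]]]; exists C, c; split=> // x; rewrite mxl1_adj.
Qed.

Lemma exp_growth_nat : exp_growth (fun x => x%:R).
Proof.
exists (mxl1 1), 2%:R; split; rewrite ?mxl1_ge0 ?ler1n// => x.
have : mxl1 (x%:R : 'M[R[i]]_N.+1) <= mxl1 1 * x%:R.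
  elim: x => [|x IH].
    by rewrite mulr0 /mxl1 big1// => j _; rewrite big1// => k _; rewrite mxE Normc.normc0.
  by rewrite !mulrS mulrDr mulr1 (le_trans (mxl1D _ _))// lerD2l.
move=> /le_trans; apply; rewrite ler_wpM2l ?mxl1_ge0// -natrX ler_nat.
exact/ltnW/ltn_expl.
Qed.

Lemma exp_growth_horner (P : {poly 'M[R[i]]_N.+1}) :
  exp_growth (fun x => P.[x%:R]).
Proof.
elim/poly_ind: P => [|P M IH].
  by have := exp_growth_cst 0; congr exp_growth; apply/funext => x; rewrite horner0.
rewrite (_ : (fun _ => _) = (fun x => P.[x%:R] * x%:R + M)).
  exact: exp_growthD (exp_growthM IH exp_growth_nat) (exp_growth_cst M).
by apply/funext => x; rewrite hornerMXaddC.
Qed.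

Local Open Scope classical_set_scope.

(** Each entry is bounded by C (a c)^x / x!, whose sum is an exponential; the real
and imaginary parts therefore converge absolutely. *)
Lemma mxseries_to_exists (a : R) f : 0 < a -> exp_growth f ->
  exists S, mxseries_to (fun x => (a ^+ x / (x`!)%:R)%:C *: f x) S.
Proof.
move=> a0 [C [c [C0 c1 fC]]].
pose w x := a ^+ x / (x`!)%:R.
have w0 x : 0 <= w x by rewrite divr_ge0 ?exprn_ge0// ltW.
have bnd (h : R[i] -> R) j k : (forall z, `|h z| <= normc z) ->
    cvgn (series (fun x => h (((w x)%:C *: f x) j k))).
  move=> hz; apply: normed_cvg.
  apply: (@series_le_cvg _ _ (C *: exp_coeff (a * c))) => [x|x|x|].
  - exact: normr_ge0.
  - rewrite mulr_ge0// exp_coeff_ge0// mulr_ge0 ?ltW//.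
    by rewrite (lt_le_trans ltr01).
  - rewrite (le_trans (hz _))// mxE Normc.normcM.
    have -> : normc (w x)%:C = w x.
      by rewrite /= expr0n /= addr0 sqrtr_sqr ger0_norm.
    rewrite [leRHS](_ : _ = a ^+ x / x`!%:R * (C * c ^+ x)); last first.
      rewrite exp_coeffE.
      change (C * (x`!%:R^-1 * (a * c) ^+ x) = a ^+ x / x`!%:R * (C * c ^+ x)).
      by rewrite exprMn; ring.
    by rewrite ler_wpM2l ?w0// (le_trans (normc_le_mxl1 _ _ _)).
  - by rewrite seriesZ; apply: is_cvgZr; exact: is_cvg_series_exp_coeff.
have reb (z : R[i]) : `|complex.Re z| <= normc z.
  by have := normc_ge_Re z; rewrite normc_def lecR; case: z.
have imb (z : R[i]) : `|complex.Im z| <= normc z.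
  by have := normc_ge_Im z; rewrite normc_def lecR; case: z.
exists (\matrix_(j, k)
  ((limn (series (fun x => complex.Re (((w x)%:C *: f x) j k)))) +i*
   (limn (series (fun x => complex.Im (((w x)%:C *: f x) j k)))))%C) => j k.
rewrite [X in _ --> X]mxE; apply/cvg_complexP; split => /=.
  rewrite (_ : (fun _ => _) = series (fun x => complex.Re (((w x)%:C *: f x) j k))).
    exact: bnd.
  by apply/funext => n; rewrite summxE raddf_sum.
rewrite (_ : (fun _ => _) = series (fun x => complex.Im (((w x)%:C *: f x) j k))).
  exact: bnd.
by apply/funext => n; rewrite summxE raddf_sum.
Qed.

End Growth.

(** * Norms of orthogonal polynomials with ladder operators *)

Section LadderRecurrence.
Variables (R : realType) (N : nat).
Local Notation Mx := 'M[R[i]]_N.+1.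
Variables (ip : {poly Mx} -> {poly Mx} -> Mx).
Variables (P : nat -> {poly Mx}) (H : nat -> Mx).
Implicit Types (Q L : {poly Mx}) (M : Mx).
Hypotheses (ip_adj : forall Q L, adjmx (ip Q L) = ip L Q).
Hypotheses (ipDl : forall Q Q' L, ip (Q + Q') L = ip Q L + ip Q' L).
Hypotheses (ipZl : forall M Q L, ip (M *: Q) L = M * ip Q L).
Hypotheses (P_monic : forall n, P n \is monic /\ size (P n) = n.+1).
Hypotheses (ip_P : forall m n, ip (P m) (P n) = if m == n then H m else 0).

Lemma size_P n : size (P n) = n.+1.
Proof. by have [] := P_monic n. Qed.

Lemma coef_P n : (P n)`_n = 1.
Proof. by have [/monicP] := P_monic n; rewrite lead_coefE => + sP; rewrite sP. Qed.

Lemma ipDr Q L L' : ip Q (L + L') = ip Q L + ip Q L'.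
Proof. by rewrite -ip_adj ipDl adjmxD !ip_adj. Qed.

Lemma ipZr M Q L : ip Q (M *: L) = ip Q L * adjmx M.
Proof. by rewrite -ip_adj ipZl adjmxM ip_adj. Qed.

Lemma ip_PP n : ip (P n) (P n) = H n.
Proof. by rewrite ip_P eqxx. Qed.

Lemma size_sub_lead Q n : (size Q <= n.+1)%N ->
  (size (Q - Q`_n *: P n)%R <= n)%N.
Proof.
move=> sQ; apply/leq_sizeP => i; rewrite leq_eqVlt => /orP[/eqP <-|ni].
  by rewrite coefB coefZ coef_P mulr1 subrr.
have sPi : (size (P n) <= i)%N by rewrite size_P.
rewrite coefB coefZ (nth_default _ (leq_trans sQ ni)) (nth_default _ sPi).
by rewrite mulr0 subrr.
Qed.

Lemma ip_orth Q n : (size Q <= n)%N -> ip Q (P n) = 0.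
Proof.
suff orth m : forall Q, (size Q <= m)%N -> (m <= n)%N -> ip Q (P n) = 0.
  by move=> sQ; exact: (orth n).
elim: m => [|m IH] {}Q sQ mn.
  have -> : Q = 0 *: Q by rewrite scale0r; apply/size_poly_leq0P.
  by rewrite ipZl mul0r.
rewrite -(subrK (Q`_m *: P m) Q) ipDl ipZl IH ?size_sub_lead//; last exact: ltnW.
by rewrite ip_P ltn_eqF// mulr0 addr0.
Qed.

(** Subtracting the leading multiple of P_n leaves a polynomial of lower degree,
which is orthogonal to P_n. *)
Lemma ip_lead Q n : (size Q <= n.+1)%N -> ip Q (P n) = Q`_n * H n.
Proof.
move=> sQ; rewrite -{1}(subrK (Q`_n *: P n) Q) ipDl ipZl ip_PP.
by rewrite ip_orth ?add0r// size_sub_lead.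
Qed.

Lemma H_hermitian n : adjmx (H n) = H n.
Proof. by rewrite -ip_PP ip_adj. Qed.

Lemma ip_orthr Q n : (size Q <= n)%N -> ip (P n) Q = 0.
Proof. by move=> sQ; rewrite -ip_adj ip_orth// adjmx0. Qed.

Lemma ip_leadr Q n : (size Q <= n.+1)%N -> ip (P n) Q = H n * adjmx Q`_n.
Proof. by move=> sQ; rewrite -ip_adj ip_lead// adjmxM H_hermitian. Qed.

Hypothesis (H_unit : forall n, H n \is a GRing.unit).

(** The matrices H_n do not commute with the coefficients, which is why they stay in
the middle.  Induction on the degree, splitting off the leading term. *)
Lemma parseval Q n : (size Q <= n)%N ->
  ip Q Q = \sum_(k < n) ip Q (P k) * (H k)^-1 * adjmx (ip Q (P k)).
Proof.
elim: n Q => [|n IH] Q sQ.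
  rewrite big_ord0; have -> : Q = 0 *: Q by rewrite scale0r; apply/size_poly_leq0P.
  by rewrite ipZl mul0r.
rewrite big_ord_recr /= (ip_lead sQ) mulrK ?H_unit// adjmxM H_hermitian.
have sQ' := size_sub_lead sQ.
move: (subrK (Q`_n *: P n) Q) sQ'; move: (Q`_n) => c; move: (Q - _) => Q' QE sQ'.
have -> : \sum_(k < n) ip Q (P k) * (H k)^-1 * adjmx (ip Q (P k)) = ip Q' Q'.
  rewrite IH//; apply: eq_bigr => k _; suff -> : ip Q (P k) = ip Q' (P k) by [].
  by rewrite -QE ipDl ipZl ip_P gtn_eqF// mulr0 addr0.
rewrite -QE ipDl !ipDr !ipZl !ipZr ip_PP ip_orth// ip_orthr//.
by rewrite mul0r mulr0 add0r addr0 mulrA.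
Qed.

(* B records the action of the ladder operators on leading coefficients. *)
Variables (c : R) (B : Mx) (raising lowering : {poly Mx} -> {poly Mx}).
Local Notation Bs := (adjmx B).
Hypotheses (c_gt0 : 0 < c).
Hypotheses (size_raising : forall n Q,
  (size Q <= n)%N -> (size (raising Q) <= n.+1)%N).
Hypotheses (size_lowering : forall n Q,
  (size Q <= n)%N -> (size (lowering Q) <= n)%N).
Hypotheses (coef_raising : forall n Q,
  (size Q <= n.+1)%N -> (raising Q)`_n.+1 = Q`_n * B^-1).
Hypotheses (coef_lowering : forall n Q,
  (size Q <= n.+1)%N -> (lowering Q)`_n = Q`_n * B).
Hypotheses (ip_raising : forall Q L, ip (raising Q) L = c%:C *: ip Q (lowering L)).
Hypotheses (ip_lowering_raising : forall Q L,
  ip L (lowering (raising Q)) = ip L Q + ip L (raising (lowering Q))).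

(** The Heisenberg relation, moved across the inner product.  It is the only link
between consecutive norms. *)
Lemma ip_raising2 Q : ip (raising Q) (raising Q) =
  c%:C *: ip Q Q + c%:C ^+ 2 *: ip (lowering Q) (lowering Q).
Proof.
rewrite ip_raising ip_lowering_raising -[ip Q (raising _)]ip_adj ip_raising.
by rewrite adjmxZ ip_adj scalerDr scalerA expr2.
Qed.

Let sP n : (size (P n) <= n.+1)%N.
Proof. by rewrite size_P. Qed.

Lemma ip_raising_P_low n k : (k < n)%N -> ip (raising (P n)) (P k) = 0.
Proof.
move=> kn; rewrite ip_raising ip_orthr ?scaler0//.
exact: leq_trans (size_lowering (sP k)) kn.
Qed.

Lemma ip_raising_P_diag n : ip (raising (P n)) (P n) = c%:C *: (H n * Bs).
Proof.
rewrite ip_raising (ip_leadr (size_lowering (sP n))) (coef_lowering (sP n)).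
by rewrite coef_P mul1r.
Qed.

Lemma ip_raising_P_up n : ip (raising (P n)) (P n.+1) = B^-1 * H n.+1.
Proof.
by rewrite (ip_lead (size_raising (sP n))) (coef_raising (sP n)) coef_P mul1r.
Qed.

Lemma ip_lowering_P_diag n : ip (lowering (P n)) (P n) = B * H n.
Proof.
by rewrite (ip_lead (size_lowering (sP n))) (coef_lowering (sP n)) coef_P mul1r.
Qed.

Lemma ip_lowering_P n k :
  c%:C *: ip (lowering (P n)) (P k) = adjmx (ip (raising (P k)) (P n)).
Proof. by rewrite ip_raising adjmxZ ip_adj. Qed.

(** The components along P_k with k < n vanish because lowering P_k has too small a
degree; only k = n and k = n + 1 survive. *)
Lemma norm_raising n : ip (raising (P n)) (raising (P n)) =
  c%:C ^+ 2 *: (H n * Bs * (H n)^-1 * B * H n) + B^-1 * H n.+1 * Bs^-1.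
Proof.
rewrite (parseval (size_raising (sP n))) !big_ord_recr /=.
rewrite big1 ?add0r => [|k _]; last by rewrite ip_raising_P_low ?mul0r//.
rewrite ip_raising_P_diag ip_raising_P_up adjmxZ !adjmxM adjmxV !H_hermitian adjmxK.
by rewrite mulrK ?H_unit// -!scalerAl -scalerAr scalerA -expr2 !mulrA.
Qed.

Lemma norm_lowering0 : ip (lowering (P 0)) (lowering (P 0)) = B * H 0 * Bs.
Proof.
rewrite (parseval (size_lowering (sP 0))) big_ord_recr big_ord0 /= add0r.
by rewrite ip_lowering_P_diag mulrK ?H_unit// adjmxM H_hermitian mulrA.
Qed.

(** The factor c^2 clears the 1 / c that the adjunction puts on the component along
P_n. *)
Lemma norm_lowering n : c%:C ^+ 2 *: ip (lowering (P n.+1)) (lowering (P n.+1)) =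
  c%:C ^+ 2 *: (B * H n.+1 * Bs) + H n.+1 * Bs^-1 * (H n)^-1 * B^-1 * H n.+1.
Proof.
have up : c%:C *: ip (lowering (P n.+1)) (P n) = H n.+1 * Bs^-1.
  by rewrite ip_lowering_P ip_raising_P_up adjmxM adjmxV H_hermitian.
have low k : (k < n)%N -> ip (lowering (P n.+1)) (P k) = 0.
  move=> kn; have /eqP := ip_lowering_P n.+1 k.
  have kn' : (size (raising (P k)) <= n.+1)%N.
    exact: leq_trans (size_raising (sP k)) _.
  rewrite (ip_orth kn') adjmx0.
  rewrite scaler_eq0 => /orP[/eqP c0|/eqP//].
  by move: c_gt0; rewrite -ltcR c0 ltxx.
rewrite (parseval (size_lowering (sP n.+1))) !big_ord_recr /=.
rewrite big1 ?add0r => [|k _]; last by rewrite low ?mul0r.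
rewrite ip_lowering_P_diag (mulrK (H_unit _)) adjmxM H_hermitian mulrA.
move: (ip _ _) up => G up.
have -> : H n.+1 / Bs / H n / B * H n.+1 = c%:C ^+ 2 *: (G / H n * adjmx G).
  transitivity ((c%:C *: G) / H n * adjmx (c%:C *: G)); last first.
    by rewrite adjmxZ -!scalerAl -scalerAr scalerA -expr2.
  by rewrite up adjmxM adjmxV adjmxK H_hermitian !mulrA.
by rewrite addrC scalerDr.
Qed.

Lemma ladder_rec0 : B^-1 * H 1 * Bs^-1 =
  c%:C ^+ 2 *: (B * H 0 * Bs) - c%:C ^+ 2 *: (H 0 * Bs * (H 0)^-1 * B * H 0)
  + c%:C *: H 0.
Proof.
have := ip_raising2 (P 0); rewrite norm_raising norm_lowering0 ip_PP.
by move=> /(canRL (addKr _)) ->; rewrite addrCA addrC [- _ + _]addrC.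
Qed.

Lemma ladder_recS n : B^-1 * H n.+2 * Bs^-1 =
  c%:C ^+ 2 *: (B * H n.+1 * Bs)
  - c%:C ^+ 2 *: (H n.+1 * Bs * (H n.+1)^-1 * B * H n.+1)
  + c%:C *: H n.+1 + H n.+1 * Bs^-1 * (H n)^-1 * B^-1 * H n.+1.
Proof.
have := ip_raising2 (P n.+1); rewrite norm_raising norm_lowering ip_PP.
move=> /(canRL (addKr _)) ->; rewrite -!addrA.
rewrite (addrCA (c%:C *: H n.+1)); exact: addrCA.
Qed.

End LadderRecurrence.

(** * The grading by row index *)

(** The derivation M -> J M - M J applied to B^x T Bs^x: T is killed, and each
side contributes the derivative of its power. *)
Lemma commutator_sandwich (K : nzRingType) (J A B T As Bs : K) x :
    J * B ^+ x.+1 = B ^+ x.+1 * J + (A * B ^+ x) *+ x.+1 ->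
    Bs ^+ x.+1 * J = J * Bs ^+ x.+1 + (Bs ^+ x * As) *+ x.+1 ->
    J * T = T * J ->
  J * (B ^+ x.+1 * T * Bs ^+ x.+1) - B ^+ x.+1 * T * Bs ^+ x.+1 * J =
  (A * (B ^+ x * T * Bs ^+ x) * Bs - B * (B ^+ x * T * Bs ^+ x) * As) *+ x.+1.
Proof.
move=> JB BJ JT.
rewrite -[_ * J]mulrA BJ !mulrA JB mulrDr !mulrDl -(mulrA _ J T) JT !mulrA.
rewrite opprD addrACA subrr add0r mulrnBl !mulrnAl mulrnAr !mulrA.
by rewrite -exprS -(mulrA _ (Bs ^+ x) Bs) -exprSr.
Qed.

Section Grading.
Variables (R : realType) (N : nat) (a : R) (mu : 'I_N.+1 -> R).
Hypotheses (mu_gt0 : forall j, 0 < mu j).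
Local Notation Mx := 'M[R[i]]_N.+1.
Implicit Types (M D : Mx).
Local Notation A := (Amx mu).
Local Notation As := (adjmx (Amx mu)).
Local Notation B := (1 + Amx mu).
Local Notation L0 := (L0mx a mu).

(** Its diagonal entries are distinct, so its commutant consists of the diagonal
matrices, and A raises the degree that it measures by one. *)
Definition grading : Mx := diag_mx (\row_j (j : nat)%:R).
Local Notation J := grading.

Lemma gradingMl M j k : (J * M) j k = (j : nat)%:R * M j k.
Proof. by rewrite -[J * M]/(J *m M) mul_diag_mx !mxE. Qed.

Lemma gradingMr M j k : (M * J) j k = M j k * (k : nat)%:R.
Proof. by rewrite -[M * J]/(M *m J) mul_mx_diag !mxE. Qed.

Lemma adj_grading : adjmx J = J.
Proof.
apply/matrixP => j k; rewrite adjmxE !mxE eq_sym.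
by case: eqVneq => [->|_]; rewrite ?mulr1n ?mulr0n ?conjc0// conjc_nat.
Qed.

Lemma comm_grading_diag M : GRing.comm J M -> is_diag_mx M.
Proof.
move=> JM; apply/is_diag_mxP => j k jk.
have := congr1 (fun M : Mx => M j k) JM; rewrite gradingMl gradingMr mulrC.
move/eqP; rewrite -subr_eq0 -mulrBr mulf_eq0 => /orP[/eqP//|].
by rewrite subr_eq0 eqr_nat (negbTE jk).
Qed.

Lemma AmxX_entry m j k :
  (A ^+ m) j k = if j == (k + m)%N :> nat then (mu j / mu k)%:C else 0.
Proof.
elim: m j => [|m IH] j.
  rewrite expr0 mxE addn0 -val_eqE /=; case: eqVneq => // /val_inj ->.
  by rewrite divff ?gt_eqF.
rewrite exprS mxE addnS; case: eqVneq => [jk|njk].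
  have lN : (k + m < N.+1)%N by rewrite (leq_trans _ (ltn_ord j))// jk.
  rewrite (bigD1 (Ordinal lN))//= IH eqxx big1 => [|l nl].
    rewrite addr0 mxE /= jk eqxx -rmorphM mulrA; congr (_ %:C).
    by rewrite mulfVK// gt_eqF.
  rewrite IH; case: eqVneq => [lk|]; last by rewrite mulr0.
  by move: nl; rewrite -val_eqE /= lk eqxx.
apply: big1 => l _; rewrite IH; case: eqVneq => [lk|]; last by rewrite mulr0.
by rewrite mxE lk (negbTE njk) rmorph0 mul0r.
Qed.

Lemma gradingAX m : J * A ^+ m = A ^+ m * J + A ^+ m *+ m.
Proof.
apply/matrixP => j k; rewrite [RHS]mxE gradingMl gradingMr mulmxnE AmxX_entry.
case: eqVneq => [->|_]; last by rewrite mulr0 mul0r mul0rn addr0.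
by rewrite natrD mulrDl mulrC mulr_natl.
Qed.

Lemma gradingA : J * A = A * J + A.
Proof. by have := gradingAX 1; rewrite expr1 mulr1n. Qed.

Lemma gradingAs : As * J = J * As + As.
Proof.
by have := congr1 (@adjmx R _ _) gradingA; rewrite adjmxD !adjmxM adj_grading.
Qed.

Lemma gradingBX x : J * B ^+ x.+1 = B ^+ x.+1 * J + (A * B ^+ x) *+ x.+1.
Proof.
have JB : J * B = B * J + A by rewrite mulrDr mulrDl mulr1 mul1r gradingA addrA.
elim: x => [|x IH]; first by rewrite expr0 expr1 mulr1.
have AB : B * A = A * B by rewrite mulrDl mulrDr mul1r mulr1.
rewrite exprS mulrA JB mulrDl -[B * J * _]mulrA IH mulrDr mulrA -exprS.
by rewrite mulrnAr mulrA AB -mulrA -exprS -addrA -mulrSr.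
Qed.

Lemma comm_grading_AXAs M : GRing.comm J M -> GRing.comm J (A * M * As).
Proof.
move=> JM; rewrite /GRing.comm -!mulrA gradingAs [LHS]mulrA gradingA.
by rewrite mulrDl !mulrDr -[A * J * _]mulrA [J * (M * _)]mulrA JM -[M * J * _]mulrA.
Qed.

Lemma comm_grading_AsXA M : GRing.comm J M -> GRing.comm J (As * M * A).
Proof.
move=> JM; rewrite /GRing.comm -[As * M * A * J]mulrA.
have -> : A * J = J * A - A by rewrite gradingA addrK.
have JAs : J * As = As * J - As by rewrite gradingAs addrK.
by rewrite !mulrA JAs mulrBl mulrBr mulrBl -(mulrA As J) JM !mulrA.
Qed.

Let exp_coef m : R[i] := ((- a) ^+ m / m`!%:R)%:C.

(** L0 is exp (- a A), a finite sum because A is nilpotent. *)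
Lemma L0mx_exp : L0 = \sum_(m < N.+1) exp_coef m *: A ^+ m.
Proof.
apply/matrixP => j k; rewrite mxE summxE.
under eq_bigr do rewrite mxE AmxX_entry.
case: leqP => [kj|jk]; last first.
  rewrite big1// => m _; case: eqVneq => [jm|]; last by rewrite mulr0.
  by move: jk; rewrite jm ltnNge leq_addr.
have lN : (j - k < N.+1)%N by rewrite (leq_ltn_trans (leq_subr _ _)).
rewrite (bigD1 (Ordinal lN))//= subnKC// eqxx big1 ?addr0 => [|m nm].
  by rewrite -rmorphM mulrC.
case: eqVneq => [jm|]; last by rewrite mulr0.
by move: nm; rewrite -val_eqE /= jm addKn eqxx.
Qed.

Lemma L0mx_commA : GRing.comm L0 A.
Proof.
rewrite L0mx_exp; apply/commr_sym/commr_sum => m _.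
by rewrite /GRing.comm -scalerAl -scalerAr -exprS -exprSr.
Qed.

Lemma L0mx_unit : L0 \is a GRing.unit.
Proof.
change (L0 \in unitmx).
have tL : is_trig_mx L0.
  by apply/is_trig_mxP => j k jk; rewrite mxE leqNgt jk.
rewrite unitmxE det_trig// big1 ?unitr1// => j _.
by rewrite mxE leqnn subnn expr0 fact0 divr1 mulr1 divff ?gt_eqF.
Qed.

(** The commutator with J is a derivation that multiplies A^m by m, so it acts on
power series in A as A d/dA, and A d/dA exp (- a A) = - a A exp (- a A). *)
Lemma gradingL0 : J * L0 = L0 * J - a%:C *: (A * L0).
Proof.
have AN : A ^+ N.+1 = 0.
  apply/matrixP => j k; rewrite AmxX_entry mxE ifF//; apply/negbTE.
  by rewrite neq_ltn (leq_trans (ltn_ord j))// leq_addl.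
rewrite L0mx_exp mulr_sumr mulr_suml -[in RHS]mulrN1.
have -> : \sum_(m < N.+1) J * (exp_coef m *: A ^+ m) =
   \sum_(m < N.+1) (exp_coef m *: A ^+ m) * J + \sum_(m < N.+1) exp_coef m *: (A ^+ m *+ m).
  rewrite -big_split; apply: eq_bigr => m _ /=.
  by rewrite -scalerAr gradingAX scalerDr scalerAl.
congr (_ + _); rewrite big_ord_recl mulr0n scaler0 add0r mulrN1.
rewrite mulr_sumr big_ord_recr /= -scalerAr -exprS AN scaler0 addr0.
rewrite scaler_sumr -sumrN; apply: eq_bigr => m _.
rewrite -scalerAr -exprS scalerA -scaler_nat scalerA -scaleNr; congr (_ *: _).
rewrite -(rmorph_nat (real_complex R)) -!rmorphM -rmorphN; congr (_ %:C).
rewrite /bump /= add1n exprS factS natrM; field.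
by rewrite nat1r !pnatr_eq0 -lt0n fact_gt0.
Qed.

(** The hypothesis amounts to J X - X J = a (A X - X As), since the terms A X As
cancel; the two factors L0 contribute the opposite. *)
Lemma comm_grading_L0_sandwich X :
    J * X - X * J = a%:C *: (A * X * adjmx B - B * X * As) ->
  GRing.comm J (L0 * X * adjmx L0).
Proof.
have L0A : L0 * A = A * L0 := L0mx_commA.
have LAs : As * adjmx L0 = adjmx L0 * As by rewrite -!adjmxM L0A.
have LsJ : adjmx L0 * J = J * adjmx L0 - a%:C *: (adjmx L0 * As).
  have := congr1 (@adjmx R _ _) gradingL0.
  by rewrite -scaleNr -rmorphN adjmxD adjmxZ !adjmxM adj_grading rmorphN scaleNr.
have -> : A * X * adjmx B - B * X * As = A * X - X * As.
  by rewrite adjmxD adjmx1 mulrDr mulr1 2!mulrDl mul1r opprD addrACA subrr addr0.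
move/(canRL (subrK _)) => JX; rewrite /GRing.comm.
rewrite -[RHS]mulrA LsJ !mulrA gradingL0 mulrBl mulrBl -(mulrA L0 J X) JX.
rewrite -!scalerAl mulrBr mulrDr mulrDl -!scalerAr -!scalerAl.
rewrite mulrBr mulrBl scalerBr !mulrA L0A -(mulrA (L0 * X)) LAs mulrA.
have cancel (V : zmodType) (u v w : V) : u - v + w - u = w - v.
  by rewrite addrAC (addrAC u) subrr add0r addrC.
exact: cancel.
Qed.

End Grading.

(** * Shifts of matrix polynomials *)

Section Shift.
Variables (K : nzRingType).
Implicit Types (p : {poly K}) (c x : K).

(** Composition with a translation.  Over a noncommutative coefficient ring it
evaluates as expected only at points that commute with c. *)
Definition polyshift c p := p \Po ('X - c%:P).

Lemma size_polyshift c p : (size (polyshift c p) <= size p)%N.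
Proof.
have [->|p0] := eqVneq p 0; first by rewrite /polyshift comp_poly0.
rewrite (leq_trans (size_comp_poly_leq _ _))// size_XsubC muln1 prednK//.
by rewrite size_poly_gt0.
Qed.

Lemma coef_polyshift_last c p n : (size p <= n.+1)%N -> (polyshift c p)`_n = p`_n.
Proof.
rewrite leq_eqVlt ltnS => /orP[/eqP sp|sp]; last first.
  by rewrite !nth_default// (leq_trans (size_polyshift _ _)).
rewrite /polyshift comp_polyE sp big_ord_recr/= coefD coefZ.
have := monic_exp n (monicXsubC c).
rewrite monicE lead_coefE size_exp_XsubC => /eqP ->; rewrite mulr1.
rewrite coef_sum big1 ?add0r// => i _.
rewrite coefZ (nth_default 0) ?mulr0//.
exact: leq_trans (eq_leq (size_exp_XsubC _ _)) _.
Qed.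

Lemma horner_polyshift c p x : GRing.comm x c -> (polyshift c p).[x] = p.[x - c].
Proof.
move=> xc; rewrite /polyshift comp_polyE horner_sum horner_coef.
apply: eq_bigr => i _; rewrite hornerZ horner_exp_comm ?hornerXsubC//.
by rewrite /comm_poly hornerXsubC mulrBr mulrBl xc.
Qed.

End Shift.

(** Entry by entry this is a scalar polynomial of degree at most n with more than
n roots. *)
Lemma mxpoly_row_eq0 (R : realType) (N : nat) (Q : {poly 'M[R[i]]_N.+1}) n
    (r : 'rV[R[i]]_N.+1) : (size Q <= n.+1)%N ->
  (forall x : nat, r *m Q.[x%:R] = 0) -> r *m Q`_n = 0.
Proof.
move=> sQ rQ; apply/rowP => k; rewrite [RHS]mxE.
pose p : {poly R[i]} := \poly_(l < n.+1) (r *m Q`_l) 0 k.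
have -> : (r *m Q`_n) 0 k = p`_n by rewrite coef_poly ltnSn.
suff -> : p = 0 by rewrite coef0.
apply: (@roots_geq_poly_eq0 _ _ [seq x%:R | x <- iota 0 n.+1]).
- apply/allP => _ /mapP[x _ ->]; apply/eqP; rewrite horner_poly.
  transitivity ((r *m Q.[x%:R]) 0 k); last by rewrite rQ mxE.
  rewrite (horner_coef_wide _ sQ) mulmx_sumr summxE; apply: eq_bigr => l _.
  by rewrite -!natrX !mulr_natr (raddfMn (mulmx r)) mulmxnE.
- by rewrite map_inj_uniq ?iota_uniq//; exact: mulrIn (oner_neq0 _).
- by rewrite size_map size_iota size_poly.
Qed.

(** * The Charlier inner product *)

Section Charlier.
Variables (R : realType) (N : nat) (a : R) (mu delta : 'I_N.+1 -> R) (lambda : nat).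
Hypotheses (a_gt0 : 0 < a).
Local Notation Mx := 'M[R[i]]_N.+1.
Implicit Types (P Q L : {poly Mx}) (M S : Mx).

Local Notation A := (Amx mu).
Local Notation B := (1 + Amx mu).
Local Notation T := (Tmx delta).
Local Notation W := (charlier_weight a mu delta lambda).
Local Notation ip := (mxinner W).

Lemma Amx_trig : is_trig_mx A.
Proof.
apply/is_trig_mxP => j k jk; rewrite mxE ifF ?rmorph0//.
by apply/negbTE; rewrite neq_ltn (leq_trans jk).
Qed.

Lemma one_plus_Amx_unit : B \is a GRing.unit.
Proof.
change (B \in unitmx).
have tB : is_trig_mx B.
  apply/is_trig_mxP => j k jk; rewrite mxE (is_trig_mxP Amx_trig)// addr0 mxE.
  by rewrite -val_eqE /= ltn_eqF.
rewrite unitmxE det_trig// big1 ?unitr1// => j _.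
rewrite !mxE eqxx ifF ?rmorph0 ?addr0//.
by apply/negbTE; rewrite neq_ltn ltnSn.
Qed.

Lemma adj_one_plus_Amx : adjmx B = 1 + adjmx A.
Proof. by rewrite adjmxD adjmx1. Qed.

Lemma weightE x : W x = (a ^+ x / x`!%:R)%:C *:
  (B ^+ (x + lambda) * T * adjmx B ^+ (x + lambda)).
Proof. by rewrite adj_one_plus_Amx. Qed.

Lemma adj_Tmx : adjmx T = T.
Proof.
apply/matrixP => j k; rewrite adjmxE !mxE eq_sym.
by case: eqVneq => [->|_]; rewrite ?mulr1n ?mulr0n /= ?oppr0.
Qed.

Lemma weight_hermitian x : adjmx (W x) = W x.
Proof.
by rewrite weightE adjmxZ !adjmxM !adjmxX adjmxK adj_Tmx mulrA.
Qed.

(** The Pearson equation. *)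
Lemma weightS x : x.+1%:R * W x.+1 = a%:C *: (B * W x * adjmx B).
Proof.
rewrite !weightE addSn mulr_natl -scaler_nat scalerA.
rewrite -scalerAr -scalerAl scalerA; congr (_ *: _); last first.
  by rewrite exprS exprSr !mulrA.
rewrite -(rmorph_nat (real_complex R)) -!rmorphM; congr (_ %:C).
rewrite exprS factS natrM /=; field.
by rewrite nat1r !pnatr_eq0 -lt0n fact_gt0.
Qed.

Definition ip_term P Q x := P.[x%:R] * W x * adjmx Q.[x%:R].

Lemma ip_series P Q : mxseries_to (ip_term P Q) (ip P Q).
Proof.
suff [S hS] : exists S, mxseries_to (ip_term P Q) S.
  by rewrite /mxinner (mxseries_lim hS).
have gr : exp_growth (fun x => P.[x%:R] *
    ((B ^+ x * (B ^+ lambda * T * adjmx B ^+ lambda)) * adjmx B ^+ x) * adjmx Q.[x%:R]).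
  apply: exp_growthM; last by apply: exp_growth_adj; exact: exp_growth_horner.
  apply: exp_growthM; first exact: exp_growth_horner.
  apply: exp_growthM; last exact: exp_growthX.
  by apply: exp_growthM; [exact: exp_growthX|exact: exp_growth_cst].
have [S hS] := mxseries_to_exists a_gt0 gr; exists S; apply: (mxseries_to_eq hS) => x.
rewrite /ip_term weightE -scalerAr -scalerAl; congr (_ *: _).
by rewrite exprD (addnC x) exprD !mulrA.
Qed.

(* From here on the inner product enters only through [ip_series], and the weight
   through [weightE], [weightS] and [weight_hermitian]. *)
#[local] Opaque mxinner charlier_weight.

Lemma ip_eq P Q S : mxseries_to (ip_term P Q) S -> ip P Q = S.
Proof. exact/mxseries_to_unique/ip_series. Qed.

Lemma ip_adj P Q : adjmx (ip P Q) = ip Q P.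
Proof.
apply/esym/ip_eq. apply: (mxseries_to_eq (mxseries_to_adj (@ip_series P Q))) => x.
by rewrite /ip_term !adjmxM adjmxK weight_hermitian mulrA.
Qed.

Lemma ipDl P Q L : ip (P + Q) L = ip P L + ip Q L.
Proof.
apply: ip_eq; apply: (mxseries_to_eq (mxseries_toD (@ip_series P L) (@ip_series Q L))) => x.
by rewrite /ip_term hornerD !mulrDl.
Qed.

Lemma ipZl M P Q : ip (M *: P) Q = M * ip P Q.
Proof.
apply: ip_eq; rewrite -[M * _]mulr1.
apply: (mxseries_to_eq (mxseries_toM (M := M) (K := 1) (@ip_series P Q))) => x.
by rewrite /ip_term hornerZ mulr1 !mulrA.
Qed.

(** The polynomial x P (x - 1) B^-1: the inverse of B compensates the factor B that
the Pearson equation leaves on the left. *)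
Definition raising P : {poly Mx} := polyshift 1 P * 'X * (B^-1)%:P.
Definition lowering P : {poly Mx} := polyshift (-1) P * B%:P.

Lemma mx_natC x M : x%:R * M = M * x%:R.
Proof. exact/commr_sym/commr_nat. Qed.

Lemma horner_mulC P M x : (P * M%:P).[x%:R] = P.[x%:R] * M.
Proof. by rewrite hornerM_comm ?hornerC// /comm_poly hornerC; exact: mx_natC. Qed.

Lemma raising0 P : (raising P).[0%:R] = 0.
Proof. by rewrite horner_mulC hornerMX mulr0 mul0r. Qed.

Lemma raisingS P x : (raising P).[x.+1%:R] = P.[x%:R] * x.+1%:R * B^-1.
Proof.
rewrite horner_mulC hornerMX horner_polyshift; last exact: mx_natC.
by rewrite mulrSr addrK.
Qed.

Lemma loweringE P x : (lowering P).[x%:R] = P.[x.+1%:R] * B.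
Proof.
rewrite horner_mulC horner_polyshift; last exact: mx_natC.
by rewrite opprK -mulrSr.
Qed.

Lemma size_raising n P : (size P <= n)%N -> (size (raising P) <= n.+1)%N.
Proof.
move=> sP; apply/leq_sizeP => i ni.
rewrite coefMC coefMX; case: i ni => //= i ni.
by rewrite nth_default ?mul0r// (leq_trans (size_polyshift _ _))// (leq_trans sP).
Qed.

Lemma size_lowering n P : (size P <= n)%N -> (size (lowering P) <= n)%N.
Proof.
move=> sP; apply/leq_sizeP => i ni; rewrite coefMC.
by rewrite nth_default ?mul0r// (leq_trans (size_polyshift _ _))// (leq_trans sP).
Qed.

Lemma coef_raising n P : (size P <= n.+1)%N -> (raising P)`_n.+1 = P`_n * B^-1.
Proof. by move=> sP; rewrite coefMC coefMX/= coef_polyshift_last. Qed.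

Lemma coef_lowering n P : (size P <= n.+1)%N -> (lowering P)`_n = P`_n * B.
Proof. by move=> sP; rewrite coefMC coef_polyshift_last. Qed.

#[local] Opaque raising lowering.

(** Summation by parts: the factor x kills the term x = 0, and the shift x -> x + 1
turns x W(x) into a B W(x) Bs by [weightS]. *)
Lemma ip_raising P Q : ip (raising P) Q = a%:C *: ip P (lowering Q).
Proof.
apply: ip_eq; apply: mxseries_to_shift.
  by rewrite /ip_term raising0 !mul0r.
rewrite -mul_scalar_mx -[_ *m _]mulr1.
have tS := @ip_series P (lowering Q).
apply: (mxseries_to_eq (mxseries_toM (M := a%:C%:M) (K := 1) tS)) => x.
rewrite /ip_term raisingS loweringE mulr1.
rewrite -[_%:M * _]/(_%:M *m _) mul_scalar_mx.
have -> : P.[x%:R] * x.+1%:R * B^-1 * W x.+1 = a%:C *: (P.[x%:R] * W x * adjmx B).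
  move: (W x) (W x.+1) (weightS x) => w w' ww'.
  rewrite -(mulrA _ x.+1%:R) mx_natC -!mulrA ww' -!scalerAr !mulrA.
  by rewrite mulrVK ?one_plus_Amx_unit.
by rewrite -scalerAl adjmxM !mulrA.
Qed.

(** (x + 1) P(x) = P(x) + x P(x).  At x = 0 the last term vanishes, so that no value
at -1 enters. *)
Lemma lowering_raising P x :
  (lowering (raising P)).[x%:R] = (P + raising (lowering P)).[x%:R].
Proof.
transitivity (P.[x%:R] * x.+1%:R).
  by rewrite loweringE raisingS mulrVK// one_plus_Amx_unit.
rewrite hornerD; case: x => [|x]; first by rewrite raising0 addr0 mulr1.
rewrite (raisingS (lowering P)) (loweringE P) -(mulrA _ B) -(mx_natC x.+1 B) mulrA.
rewrite mulrK ?one_plus_Amx_unit//.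
by rewrite [x.+2%:R]mulrS mulrDr mulr1.
Qed.

Lemma ip_lowering_raising P Q :
  ip Q (lowering (raising P)) = ip Q P + ip Q (raising (lowering P)).
Proof.
rewrite -[ip Q P]ip_adj -[ip Q (raising _)]ip_adj -adjmxD -ipDl.
apply/esym; rewrite ip_adj.
apply: ip_eq; apply: (mxseries_to_eq (@ip_series Q _)) => x.
by rewrite /ip_term lowering_raising.
Qed.

Hypotheses (delta_gt0 : forall j, 0 < delta j).
Implicit Types (r : 'rV[R[i]]_N.+1).

Lemma Tmx_form r : (r *m T *m adjmx r) 0 0 =
  \sum_k (delta k)%:C * (r 0 k * conjc (r 0 k)).
Proof.
rewrite mxE; apply: eq_bigr => k _.
by rewrite mul_mx_diag mxE adjmxE mxE mulrCA mulrA.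
Qed.

Lemma Tmx_form_ge0 r : 0 <= (r *m T *m adjmx r) 0 0.
Proof.
rewrite Tmx_form sumr_ge0// => k _.
by rewrite mulr_ge0 ?mulcJ_ge0// ler0c ltW.
Qed.

Lemma Tmx_form_eq0 r : (r *m T *m adjmx r) 0 0 = 0 -> r = 0.
Proof.
rewrite Tmx_form => /psumr_eq0P h; apply/rowP => k; rewrite mxE.
have {}h k' : (delta k')%:C * (r 0 k' * conjc (r 0 k')) = 0.
  by apply: h => // l _; rewrite mulr_ge0 ?mulcJ_ge0// ler0c ltW.
have /eqP := h k.
rewrite !mulf_eq0 conjc_eq0 orbb => /orP[/eqP d0|/eqP//].
by have := delta_gt0 k; rewrite -ltcR d0 ltxx.
Qed.

Lemma weight_form x r : (r *m W x *m adjmx r) 0 0 =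
  (a ^+ x / x`!%:R)%:C *
  ((r *m B ^+ (x + lambda)) *m T *m adjmx (r *m B ^+ (x + lambda))) 0 0.
Proof.
rewrite weightE -scalemxAr -scalemxAl mxE; congr (_ * fun_of_matrix _ 0 0).
rewrite adjmx_mul adjmxX.
by rewrite -[_ * _ * _]/(_ *m _ *m _) !mulmxA.
Qed.

Lemma weight_form_ge0 x r : 0 <= (r *m W x *m adjmx r) 0 0.
Proof.
rewrite weight_form mulr_ge0 ?Tmx_form_ge0// ler0c.
by rewrite divr_ge0 ?exprn_ge0// ltW.
Qed.

Lemma weight_form_eq0 x r : (r *m W x *m adjmx r) 0 0 = 0 -> r = 0.
Proof.
rewrite weight_form => /eqP; rewrite mulf_eq0 => /orP[/eqP w0|/eqP].
  have : 0 < a ^+ x / x`!%:R by rewrite divr_gt0 ?exprn_gt0// ltr0n fact_gt0.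
  by rewrite -ltcR w0 ltxx.
move/Tmx_form_eq0 => rB.
have uB : B ^+ (x + lambda) \in unitmx := unitrX _ one_plus_Amx_unit.
by rewrite -[r](mulmxK uB) rB mul0mx.
Qed.

(** If the form vanishes at v, each nonnegative term does, so the row adjoint to v
annihilates Q at all natural numbers and hence its leading coefficient 1. *)
Lemma ip_posdef Q : Q \is monic -> posdefmx (ip Q Q).
Proof.
move=> Qm; split; first exact: ip_adj.
move=> v v0; rewrite -[X in _ *m X]adjmxK; move rE: (adjmx v) => r.
(* The row r, repeated, makes the quadratic form an entry of a square matrix. *)
pose V : Mx := \matrix_(j, k) r 0 k.
have VE (M : Mx) : (V * M * adjmx V) 0 0 = (r *m M *m adjmx r) 0 0.
  rewrite mxE [RHS]mxE; apply: eq_bigr => k _; rewrite !adjmxE; congr (_ * conjc _).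
    by rewrite !mxE; apply: eq_bigr => l _; rewrite mxE.
  by rewrite mxE.
have hS := mxseries_toM (M := V) (K := adjmx V) (@ip_series Q Q).
have tE x : (V * ip_term Q Q x * adjmx V) 0 0 =
    ((r *m Q.[x%:R]) *m W x *m adjmx (r *m Q.[x%:R])) 0 0.
  by rewrite VE adjmx_mul /ip_term -[_ * _ * _]/(_ *m _ *m _) !mulmxA.
have t0 x : 0 <= (V * ip_term Q Q x * adjmx V) 0 0.
  by rewrite tE weight_form_ge0.
have le := mxseries_to_ge_term hS t0; rewrite -VE.
rewrite lt_def (le_trans (t0 0) (le 0))// andbT; apply/eqP => Hr0.
have /eqP : r *m lead_coef Q = 0.
  apply: mxpoly_row_eq0 => [|x]; first exact: leqSpred.
  apply: (@weight_form_eq0 x); rewrite -tE; apply/le_anti.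
  by rewrite t0 andbT -Hr0.
rewrite (monicP Qm) mulmx1 => /eqP r0.
move/eqP: v0; apply; rewrite -[v]adjmxK rE r0.
by apply/matrixP => j k; rewrite adjmxE !mxE conjc0.
Qed.

Hypotheses (mu_gt0 : forall j, 0 < mu j).
Local Notation J := (grading R N).

Lemma grading_Tmx : J * T = T * J.
Proof.
apply/matrixP => j k; rewrite gradingMl gradingMr !mxE.
by case: eqVneq => [->|_]; rewrite ?mulr1n ?mulr0n ?mulr0 ?mul0r// mulrC.
Qed.

(** The weight for lambda = 0 without its scalar factor. *)
Let bare_weight x : Mx := B ^+ x * T * adjmx B ^+ x.

Lemma grading_bare_weight x : J * bare_weight x.+1 - bare_weight x.+1 * J =
  (A * bare_weight x * adjmx B - B * bare_weight x * adjmx A) *+ x.+1.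
Proof.
have JBs : adjmx B ^+ x.+1 * J = J * adjmx B ^+ x.+1 + (adjmx B ^+ x * adjmx A) *+ x.+1.
  have := congr1 (@adjmx R _ _) (gradingBX mu_gt0 x).
  by rewrite adjmxD adjmxMn !adjmxM !adjmxX adj_grading.
exact: commutator_sandwich (gradingBX mu_gt0 x) JBs grading_Tmx.
Qed.

(** Termwise, the derivation by J produces a factor x, which the Pearson equation
trades for a shift; thus the commutator of the sum with J is again a sum of the
same kind. *)
Lemma ip_one : exists X : Mx, ip 1 1 = B ^+ lambda * X * adjmx B ^+ lambda /\
  J * X - X * J = a%:C *: (A * X * adjmx B - B * X * adjmx A).
Proof.
pose w x := (a ^+ x / x`!%:R)%:C.
have [X tX] : exists X, mxseries_to (fun x => w x *: bare_weight x) X.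
  apply: mxseries_to_exists => //; apply: exp_growthM; last exact: exp_growthX.
  by apply: exp_growthM; [exact: exp_growthX|exact: exp_growth_cst].
exists X; split.
  apply: ip_eq; apply: (mxseries_to_eq (mxseries_toM (M := B ^+ lambda)
    (K := adjmx B ^+ lambda) tX)) => x.
  rewrite /ip_term hornerC adjmx1 mulr1 mul1r weightE -scalerAr -scalerAl.
  by congr (_ *: _); rewrite addnC exprD (addnC lambda) exprD !mulrA.
have J0 : J * bare_weight 0 - bare_weight 0 * J = 0.
  by rewrite /bare_weight !expr0 mul1r mulr1 grading_Tmx subrr.
have wS x : w x.+1 * x.+1%:R = a%:C * w x.
  rewrite /w -(rmorph_nat (real_complex R)) -!rmorphM; congr (_ %:C).
  rewrite exprS factS natrM /=; field.
  by rewrite nat1r !pnatr_eq0 -lt0n fact_gt0.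
have := grading_bare_weight; move: w wS bare_weight tX J0 => w wS t tX J0 tS.
apply: (mxseries_to_unique (f := fun x => J * (w x *: t x) * 1 + (-1) * (w x *: t x) * J)).
  rewrite -[J * X]mulr1 -[X * J]mul1r mulrA -mulNr -mulNr.
  exact: mxseries_toD (mxseries_toM tX) (mxseries_toM tX).
apply: mxseries_to_shift.
  by rewrite mulr1 mulN1r mulNr -scalerAr -scalerAl -scalerBr J0 scaler0.
have -> : a%:C *: (A * X * adjmx B - B * X * adjmx A) =
   (a%:C *: A) * X * adjmx B + (- (a%:C *: B)) * X * adjmx A.
  by rewrite scalerBr !mulNr -!scalerAl.
apply: (mxseries_to_eq (mxseries_toD (mxseries_toM tX) (mxseries_toM tX))) => x /=.
move: (tS x); move: (adjmx A) (adjmx B) (grading _ _) B A => As Bs J B A {}tS.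
rewrite mulr1 mulN1r !mulNr -!scalerAr -!scalerAl -!scalerBr tS.
by rewrite -scaler_nat !scalerA wS [w x * _]mulrC.
Qed.

End Charlier.

(** * Removing the triangular factors *)

Section Cancellation.
Variables (K : unitRingType).
Implicit Types (A As B Bs C Cs D : K).

Lemma frame_up C Cs B Bs D : C * B = B * C -> Cs * Bs = Bs * Cs ->
  B * (C * D * Cs) * Bs = C * (B * D * Bs) * Cs.
Proof. by move=> CB CBs; rewrite -!mulrA CBs !mulrA -CB. Qed.

Lemma invr_mul3 C Cs D : C \is a GRing.unit -> Cs \is a GRing.unit ->
  D \is a GRing.unit -> (C * D * Cs)^-1 = Cs^-1 * D^-1 * C^-1.
Proof.
move=> uC uCs uD; have uCD : C * D \is a GRing.unit by rewrite unitrMr.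
by rewrite (invrM uCD uCs) (invrM uC uD) mulrA.
Qed.

Lemma frame_cross C Cs B Bs D : C \is a GRing.unit -> Cs \is a GRing.unit ->
    D \is a GRing.unit -> C * B = B * C -> Cs * Bs = Bs * Cs ->
  C * D * Cs * Bs * (C * D * Cs)^-1 * B * (C * D * Cs) =
  C * (D * Bs * D^-1 * B * D) * Cs.
Proof.
move=> uC uCs uD CB CBs; rewrite invr_mul3//.
rewrite -(mulrA _ Cs Bs) CBs !mulrA mulrK//.
by rewrite -(mulrA _ B C) -CB !mulrA mulrVK.
Qed.

Lemma frame_previous C Cs B Bs D D' : C \is a GRing.unit -> Cs \is a GRing.unit ->
    B \is a GRing.unit -> Bs \is a GRing.unit -> D' \is a GRing.unit ->
    C * B = B * C -> Cs * Bs = Bs * Cs ->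
  C * B * D * (Bs * Cs) * Bs^-1 * (C * D' * Cs)^-1 * B^-1 * (C * B * D * (Bs * Cs)) =
  C * B * (D * D'^-1 * D) * (Bs * Cs).
Proof.
move=> uC uCs uB uBs uD CB CBs; rewrite invr_mul3//.
have e1 : Bs * Cs * Bs^-1 * Cs^-1 = 1 by rewrite -CBs mulrK// mulrV.
have e2 : C^-1 * B^-1 * (C * B) = 1 by rewrite CB mulrA mulrVK// mulVr.
transitivity (C * B * D * (Bs * Cs * Bs^-1 * Cs^-1) * D'^-1 *
  (C^-1 * B^-1 * (C * B)) * D * (Bs * Cs)); first by rewrite !mulrA.
by rewrite e1 e2 !mulr1 !mulrA.
Qed.

(** Both products contain D + A D + D As; the difference keeps the quadratic terms. *)
Lemma cross_terms_cancel A As D : D \is a GRing.unit ->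
  (1 + A) * D * (1 + As) - D * (1 + As) * D^-1 * (1 + A) * D =
  A * D * As - D * As * D^-1 * A * D.
Proof.
move=> uD.
have -> : (1 + A) * D * (1 + As) = D + A * D + D * As + A * D * As.
  by rewrite mulrDl mul1r mulrDr mulr1 mulrDl addrA.
have -> : D * (1 + As) * D^-1 * (1 + A) * D =
    D + A * D + D * As + D * As * D^-1 * A * D.
  rewrite [D * (1 + As)]mulrDr mulr1 mulrDl mulrV// mulrDr mulr1 2!mulrDl !mul1r.
  by rewrite mulrVK// !mulrDl mul1r addrA (addrAC D).
by rewrite opprD addrACA subrr add0r.
Qed.

(** Used with b a power of B and l = L0: the powers of B drop out because they
commute with L0. *)
Lemma normalize_sandwich (b bs l ls X : K) : b \is a GRing.unit -> bs \is a GRing.unit ->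
    l \is a GRing.unit -> ls \is a GRing.unit -> l * b = b * l -> bs * ls = ls * bs ->
  (l^-1 * b)^-1 * (b * X * bs) * (bs * ls^-1)^-1 = l * X * ls.
Proof.
move=> ub ubs ul uls lb bls.
have ulV : l^-1 \is a GRing.unit by rewrite unitrV.
have ulsV : ls^-1 \is a GRing.unit by rewrite unitrV.
rewrite (invrM ulV ub) (invrM ubs ulsV) !invrK !mulrA -(mulrA b^-1) lb !mulrA mulVr//.
by rewrite mul1r -(mulrA _ bs) bls !mulrA mulrK.
Qed.

(** The middle factor of H n = C n * D n * Cs n. *)
Definition normalized (H C Cs : nat -> K) (n : nat) := (C n)^-1 * H n * (Cs n)^-1.

End Cancellation.

Section Normalization.
Variables (F : comUnitRingType) (K : unitAlgType F) (c : F) (A As : K).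
Variables (H C Cs : nat -> K).
Local Notation B := (1 + A).
Local Notation Bs := (1 + As).
Hypotheses (uB : B \is a GRing.unit) (uBs : Bs \is a GRing.unit).
Hypotheses (uC : forall n, C n \is a GRing.unit) (uCs : forall n, Cs n \is a GRing.unit).
Hypotheses (uH : forall n, H n \is a GRing.unit).
Hypotheses (CS : forall n, C n.+1 = C n * B) (CsS : forall n, Cs n.+1 = Bs * Cs n).
Hypotheses (CB : forall n, C n * B = B * C n) (CsBs : forall n, Cs n * Bs = Bs * Cs n).

Local Notation D := (normalized H C Cs).

Lemma normalizedK n : H n = C n * D n * Cs n.
Proof. by rewrite /normalized !mulrA mulrV// mul1r mulrVK. Qed.

Lemma normalized_unit n : D n \is a GRing.unit.
Proof. by rewrite /normalized unitrMl ?unitrV// unitrMr// unitrV. Qed.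

Lemma normalized_next n : B^-1 * H n.+1 * Bs^-1 = C n * D n.+1 * Cs n.
Proof.
by rewrite normalizedK CS CsS CB -CsBs !mulrA mulVr// mul1r mulrK.
Qed.

Lemma normalized_center n : c ^+ 2 *: (B * H n * Bs)
    - c ^+ 2 *: (H n * Bs * (H n)^-1 * B * H n) + c *: H n =
  C n * (c ^+ 2 *: (A * D n * As) - c ^+ 2 *: (D n * As * (D n)^-1 * A * D n)
         + c *: D n) * Cs n.
Proof.
rewrite normalizedK (frame_cross (uC n) (uCs n) (normalized_unit n) (CB n) (CsBs n)).
rewrite (frame_up _ (CB n) (CsBs n)).
rewrite -[in RHS]scalerBr -cross_terms_cancel ?normalized_unit//.
move: (B * D n * Bs) (D n * Bs * _ * B * D n) => X Y.
by rewrite mulrDr mulrDl -!scalerAr -!scalerAl mulrBr mulrBl scalerBr.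
Qed.

Lemma normalized_rec0 :
    B^-1 * H 1 * Bs^-1 = c ^+ 2 *: (B * H 0 * Bs)
      - c ^+ 2 *: (H 0 * Bs * (H 0)^-1 * B * H 0) + c *: H 0 ->
  D 1 = c ^+ 2 *: (A * D 0 * As) - c ^+ 2 *: (D 0 * As * (D 0)^-1 * A * D 0)
        + c *: D 0.
Proof. by rewrite normalized_next normalized_center => /(mulIr (uCs 0))/(mulrI (uC 0)). Qed.

Lemma normalized_recS n :
    B^-1 * H n.+2 * Bs^-1 = c ^+ 2 *: (B * H n.+1 * Bs)
      - c ^+ 2 *: (H n.+1 * Bs * (H n.+1)^-1 * B * H n.+1) + c *: H n.+1
      + H n.+1 * Bs^-1 * (H n)^-1 * B^-1 * H n.+1 ->
  D n.+2 = c ^+ 2 *: (A * D n.+1 * As)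
      - c ^+ 2 *: (D n.+1 * As * (D n.+1)^-1 * A * D n.+1) + c *: D n.+1
      + D n.+1 * (D n)^-1 * D n.+1.
Proof.
rewrite normalized_next normalized_center.
have -> : H n.+1 * Bs^-1 * (H n)^-1 * B^-1 * H n.+1 =
    C n.+1 * (D n.+1 * (D n)^-1 * D n.+1) * Cs n.+1.
  by rewrite !(normalizedK n.+1) (normalizedK n) CS CsS frame_previous ?normalized_unit.
by rewrite -mulrDl -mulrDr => /(mulIr (uCs _))/(mulrI (uC _)).
Qed.

End Normalization.

(** * The square norms of the Charlier polynomials *)

Section CharlierNorms.
Variables (R : realType) (N : nat) (a : R) (lambda : nat) (mu delta : 'I_N.+1 -> R).
Variables (P : nat -> {poly 'M[R[i]]_N.+1}) (H : nat -> 'M[R[i]]_N.+1).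
Hypotheses (a_gt0 : 0 < a) (mu_gt0 : forall j, 0 < mu j)
  (delta_gt0 : forall j, 0 < delta j)
  (PH : monic_orthogonal (charlier_weight a mu delta lambda) P H).
Local Notation A := (Amx mu).
Local Notation As := (adjmx (Amx mu)).
Local Notation B := (1 + Amx mu).
Local Notation Bs := (1 + adjmx (Amx mu)).
Local Notation L0 := (L0mx a mu).

Lemma square_norm_posdef n : posdefmx (H n).
Proof.
have [P_monic P_orth] := PH; have := P_orth n n; rewrite eqxx => <-.
by have [Pm _] := P_monic n; exact: ip_posdef.
Qed.

Lemma square_norm_unit n : H n \is a GRing.unit.
Proof. exact: posdefmx_unit (square_norm_posdef n). Qed.

Lemma charlier_norm_rec0 : B^-1 * H 1 * Bs^-1 =
  a%:C ^+ 2 *: (B * H 0 * Bs) - a%:C ^+ 2 *: (H 0 * Bs * (H 0)^-1 * B * H 0)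
  + a%:C *: H 0.
Proof.
have [P_monic P_orth] := PH; rewrite -adj_one_plus_Amx.
exact: (ladder_rec0 (ip_adj mu delta lambda a_gt0) (ipDl mu delta lambda a_gt0)
  (ipZl mu delta lambda a_gt0) P_monic P_orth square_norm_unit
  (@size_raising R N mu) (@size_lowering R N mu)
  (@coef_raising R N mu) (@coef_lowering R N mu)
  (ip_raising mu delta lambda a_gt0) (ip_lowering_raising mu delta lambda a_gt0)).
Qed.

Lemma charlier_norm_recS n : B^-1 * H n.+2 * Bs^-1 =
  a%:C ^+ 2 *: (B * H n.+1 * Bs)
  - a%:C ^+ 2 *: (H n.+1 * Bs * (H n.+1)^-1 * B * H n.+1)
  + a%:C *: H n.+1 + H n.+1 * Bs^-1 * (H n)^-1 * B^-1 * H n.+1.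
Proof.
have [P_monic P_orth] := PH; rewrite -adj_one_plus_Amx.
exact: (ladder_recS (ip_adj mu delta lambda a_gt0) (ipDl mu delta lambda a_gt0)
  (ipZl mu delta lambda a_gt0) P_monic P_orth square_norm_unit a_gt0
  (@size_raising R N mu) (@size_lowering R N mu)
  (@coef_raising R N mu) (@coef_lowering R N mu)
  (ip_raising mu delta lambda a_gt0) (ip_lowering_raising mu delta lambda a_gt0)).
Qed.

Lemma comm_grading_norm0 : GRing.comm (grading R N)
  ((L0^-1 * B ^+ lambda)^-1 * H 0 * (Bs ^+ lambda * (adjmx L0)^-1)^-1).
Proof.
have [P_monic P_orth] := PH.
have P0 : P 0 = 1.
  have [/monicP lP sP] := P_monic 0; move: lP; rewrite lead_coefE sP /= => lP.
  by rewrite [P 0]size1_polyC ?sP// lP.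
have [X [XE JX]] := ip_one delta lambda a_gt0 mu_gt0.
have := P_orth 0 0; rewrite eqxx P0 XE => <-.
have uB : B ^+ lambda \is a GRing.unit by rewrite unitrX// one_plus_Amx_unit.
have uBs : adjmx B ^+ lambda \is a GRing.unit by rewrite -adjmxX adjmx_unit.
have uL : L0 \is a GRing.unit := L0mx_unit a mu_gt0.
have uLs : adjmx L0 \is a GRing.unit by rewrite adjmx_unit.
have LB : L0 * B ^+ lambda = B ^+ lambda * L0.
  by apply: commrX; rewrite /GRing.comm mulrDr mulrDl mulr1 mul1r L0mx_commA.
have BsLs : adjmx B ^+ lambda * adjmx L0 = adjmx L0 * adjmx B ^+ lambda.
  by rewrite -adjmxX -!adjmxM LB.
rewrite -adj_one_plus_Amx (normalize_sandwich X uB uBs uL uLs LB BsLs).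
exact (comm_grading_L0_sandwich mu_gt0 JX).
Qed.

End CharlierNorms.

Theorem corollary5p7 (R : realType) (N : nat) (a : R) (lambda : nat)
    (mu delta : 'I_N.+1 -> R)
    (P : nat -> {poly 'M[R[i]]_N.+1}) (H : nat -> 'M[R[i]]_N.+1)
    (a_gt0 : 0 < a)
    (mu_gt0 : forall j, 0 < mu j)
    (delta_gt0 : forall j, 0 < delta j)
    (PH : monic_orthogonal (charlier_weight a mu delta lambda) P H) :
  let A := Amx mu in
  let L0 := L0mx a mu in
  exists D : nat -> 'M[R[i]]_N.+1,
    [/\ forall n, is_diag_mx (D n) /\ posdefmx (D n),
        forall n, H n = L0^-1 * (1 + A) ^+ (n + lambda) * D n *
                        (1 + adjmx A) ^+ (n + lambda) * (adjmx L0)^-1,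
        forall n, (2 <= n)%N ->
          D n = a%:C ^+ 2 *: (A * D n.-1 * adjmx A)
                - a%:C ^+ 2 *: (D n.-1 * adjmx A * (D n.-1)^-1 * A * D n.-1)
                + a%:C *: D n.-1
                + D n.-1 * (D n.-2)^-1 * D n.-1
      & D 1%N = a%:C ^+ 2 *: (A * D 0%N * adjmx A)
                - a%:C ^+ 2 *: (D 0%N * adjmx A * (D 0%N)^-1 * A * D 0%N)
                + a%:C *: D 0%N].
Proof.
move=> A L0; set J := grading R N.
have [C CE] : {C : nat -> 'M[R[i]]_N.+1 |
    forall n, C n = L0^-1 * (1 + A) ^+ (n + lambda)}.
  by exists (fun n => L0^-1 * (1 + A) ^+ (n + lambda)).
have adj1A : adjmx (1 + A) = 1 + adjmx A := adj_one_plus_Amx mu.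
have CsE n : adjmx (C n) = (1 + adjmx A) ^+ (n + lambda) * (adjmx L0)^-1.
  by rewrite CE adjmxM adjmxV adjmxX adj1A.
have uB : 1 + A \is a GRing.unit := one_plus_Amx_unit mu.
have uL : L0 \is a GRing.unit := L0mx_unit a mu_gt0.
have LA : L0 * A = A * L0 := L0mx_commA a mu_gt0.
have H_pos := square_norm_posdef a_gt0 delta_gt0 PH.
have rec0 := charlier_norm_rec0 a_gt0 delta_gt0 PH.
have recS := charlier_norm_recS a_gt0 delta_gt0 PH.
have JC0 : GRing.comm J ((C 0)^-1 * H 0 * (adjmx (C 0))^-1).
  by have := comm_grading_norm0 a_gt0 mu_gt0 PH; rewrite CsE CE add0n.
have JA : forall M, GRing.comm J M -> GRing.comm J (A * M * adjmx A).
  exact: comm_grading_AXAs mu_gt0.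
have JAs : forall M, GRing.comm J M -> GRing.comm J (adjmx A * M * A).
  exact: comm_grading_AsXA mu_gt0.
have diagJ : forall M, GRing.comm J M -> is_diag_mx M := @comm_grading_diag R N.
rewrite -/A in rec0 recS.
(* From here on A, L0, J and C matter only through the properties listed above. *)
move: A L0 J diagJ CE CsE adj1A uB uL LA rec0 recS JC0 JA JAs.
clear mu_gt0 delta_gt0 a_gt0 PH.
move=> A L0 J diagJ CE CsE adj1A uB uL LA rec0 recS JC0 JA JAs.
have uBs : 1 + adjmx A \is a GRing.unit by rewrite -adj1A adjmx_unit.
have uC n : C n \is a GRing.unit.
  by rewrite CE unitrMr ?unitrV// unitrX.
have uCs n : adjmx (C n) \is a GRing.unit by rewrite adjmx_unit.
have CS n : C n.+1 = C n * (1 + A) by rewrite !CE addSn exprSr mulrA.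
have CB n : C n * (1 + A) = (1 + A) * C n.
  have LB : L0 * (1 + A) = (1 + A) * L0 by rewrite mulrDr mulrDl mulr1 mul1r LA.
  have LVB : L0^-1 * (1 + A) = (1 + A) * L0^-1.
    exact: commr_sym (commrV (commr_sym LB)).
  by rewrite CE -mulrA -exprSr exprS mulrA LVB -mulrA.
have CsBs n : adjmx (C n) * (1 + adjmx A) = (1 + adjmx A) * adjmx (C n).
  by rewrite -adj1A -!adjmxM CB.
have CsS n : adjmx (C n.+1) = (1 + adjmx A) * adjmx (C n).
  by rewrite CS adjmxM adj1A.
have uH n : H n \is a GRing.unit := posdefmx_unit (H_pos n).
have D1 := normalized_rec0 uB uBs uC uCs uH CS CsS CB CsBs rec0.
have DS n := normalized_recS uB uBs uC uCs uH CS CsS CB CsBs (recS n).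
have DK := normalizedK H uC uCs.
have D_pos n : posdefmx (normalized H C (fun m => adjmx (C m)) n).
  rewrite /normalized -adjmxV; apply: posdefmx_congr (H_pos n).
  by rewrite unitrV.
have JD0 : GRing.comm J (normalized H C (fun m => adjmx (C m)) 0) := JC0.
move: (normalized H C _) JD0 D1 DS DK D_pos => D JD0 D1 DS DK D_pos.
exists D; split=> //; last first.
- by case=> [|[|n]].
- by move=> n; rewrite DK CsE CE !mulrA.
(* No term of the recurrence leaves the commutant of the grading J. *)
have Jstep M : GRing.comm J M -> GRing.comm J
    (a%:C ^+ 2 *: (A * M * adjmx A)
     - a%:C ^+ 2 *: (M * adjmx A * M^-1 * A * M) + a%:C *: M).
  move=> JM; have JMV := commrV JM.
  have JZ (c : R[i]) K : GRing.comm J K -> GRing.comm J (c *: K).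
    by rewrite /GRing.comm -scalerAr -scalerAl => ->.
  apply: commrD; last exact: JZ.
  apply: commrB; apply: JZ; first exact: JA.
  have -> : M * adjmx A * M^-1 * A * M = M * (adjmx A * M^-1 * A) * M by rewrite !mulrA.
  by apply: commrM => //; apply: commrM => //; exact: JAs.
suff JD m : GRing.comm J (D m) /\ GRing.comm J (D m.+1).
  by move=> n; split=> //; apply: diagJ; case: (JD n) => JDn _; exact: JDn.
elim: m => [|n [JDn JDn1]]; first by split=> //; rewrite D1; exact: Jstep.
split; first exact: JDn1.
rewrite DS; apply: commrD; first exact: Jstep.
by apply: commrM => //; apply: commrM => //; exact: commrV.
Qed.
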